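(* Let $F$ be a graph with at least one edge and no isolated vertices such that $\delta(F)>\frac{|V(F)|-\alpha(F)}{2}$, and let $k\geq 3$. Then $\mathrm{sat}_k(n,\text{Berge-}F)=O(n)$ as $n\to\infty$.
   Context: $\delta(F)$ is the minimum degree and $\alpha(F)$ the independence number of $F$. A hypergraph $\mathcal{H}$ is a Berge-$F$ if $F$ and $\mathcal{H}$ can be embedded on a common vertex set with a bijection $\phi:E(F)\to E(\mathcal{H})$ such that $e\subseteq\phi(e)$ for all $e\in E(F)$; a hypergraph contains a Berge-$F$ if some subset of its edges forms a Berge-$F$. A $k$-uniform hypergraph $\mathcal{H}$ is Berge-$F$-saturated if it contains no Berge-$F$ but $\mathcal{H}+e$ contains a Berge-$F$ for every $k$-set $e\subseteq V(\mathcal{H})$ with $e\notin E(\mathcal{H})$. $\mathrm{sat}_k(n,\text{Berge-}F)$ is the minimum number of edges in a Berge-$F$-saturated $k$-uniform hypergraph on $n$ vertices. The paper assumes throughout that graphs have no isolated vertices. *)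

(* Defs.v *)
From mathcomp Require Import all_boot all_order all_algebra.
From mathcomp Require Import boolp.
Set Implicit Arguments.
Unset Strict Implicit.
Unset Printing Implicit Defensive.
Import Order.TTheory.

Record sgraph := SGraph {
  vertex :> finType;
  adj : rel vertex;
  adj_sym : symmetric adj;
  adj_irrefl : irreflexive adj }.

Section Graph.
Variable F : sgraph.

Definition edges : {set {set F}} :=
  [set [set p.1; p.2] | p : F * F & adj p.1 p.2].

Definition degree (x : F) : nat := #|[set y | adj x y]|.

(* A degree is at most #|F|, so the default value of the minimum only matters
   for the graph without vertices. *)
Definition min_degree : nat := \big[minn/#|F|]_(x : F) degree x.

Definition independent (A : {set F}) : bool :=
  [forall x in A, forall y in A, ~~ adj x y].

Definition independence_number : nat :=
  \max_(A : {set F} | independent A) #|A|.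

Definition no_isolated_vertex : Prop := forall x : F, 0 < degree x.

End Graph.

Section Berge.
Variable F : sgraph.

(* A hypergraph on the vertex set V is its set of edges H : {set {set V}}.
   W is the common vertex set, i and j are the embeddings of F and H; the map
   phi is a bijection from edges F onto H. *)
Definition is_Berge (V : finType) (H : {set {set V}}) : Prop :=
  exists (W : finType) (i : F -> W) (j : V -> W) (phi : {set F} -> {set V}),
    [/\ injective i, injective j,
        {in edges F &, injective phi}, phi @: edges F = H
      & forall e, e \in edges F -> i @: e \subset j @: phi e].

Definition contains_Berge (V : finType) (H : {set {set V}}) : Prop :=
  exists2 B : {set {set V}}, B \subset H & is_Berge B.

Definition uniform (k : nat) (V : finType) (H : {set {set V}}) : Prop :=
  forall e, e \in H -> #|e| = k.

Definition Berge_saturated (k : nat) (V : finType) (H : {set {set V}}) : Prop :=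
  [/\ uniform k H, ~ contains_Berge H
    & forall e : {set V}, #|e| = k -> e \notin H -> contains_Berge (e |: H)].

(* The default value 'C(n, k) is an upper bound for the size of every k-uniform
   hypergraph on n vertices, so it does not affect the minimum; sat_attained
   and sat_min below show that this is a genuine minimum when F has an edge. *)
Definition sat (k n : nat) : nat :=
  \big[minn/'C(n, k)]_(H : {set {set 'I_n}} | `[< Berge_saturated k H >]) #|H|.

Lemma uniform_card k n (H : {set {set 'I_n}}) : uniform k H -> #|H| <= 'C(n, k).
Proof.
move=> Hk; rewrite -[X in 'C(X, k)]card_ord -card_draws.
by apply/subset_leq_card/subsetP => e /Hk; rewrite inE => ->.
Qed.

Lemma sat_min k n (H : {set {set 'I_n}}) :
  Berge_saturated k H -> sat k n <= #|H|.
Proof.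
move=> /asboolP sH.
exact: (@bigmin_le_cond _ nat _ _ H (fun A => `[< Berge_saturated k A >])).
Qed.

Lemma ex_Berge_saturated k (V : finType) :
  edges F != set0 -> exists H : {set {set V}}, Berge_saturated k H.
Proof.
move=> F0.
pose P (H : {set {set V}}) := `[< uniform k H /\ ~ contains_Berge H >].
have P0 : P set0.
  apply/asboolP; split=> [e|[B]]; first by rewrite inE.
  rewrite subset0 => /eqP -> [W [i [j [phi [_ _ _ phi0 _]]]]].
  by move/eqP: phi0; rewrite imset_eq0 (negPf F0).
have [H /maxsetP[/asboolP[Hk HF] Hmax] _] := maxset_exists P0.
exists H; split=> // e ek eH; apply: contrapT => eF.
have /Hmax eHE : P (e |: H).
  by apply/asboolP; split=> // f; rewrite !inE => /orP[/eqP -> //|/Hk].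
by move: eH; rewrite -(eHE (subsetUr _ _)) setU11.
Qed.

Lemma sat_attained k n : edges F != set0 ->
  exists2 H : {set {set 'I_n}}, Berge_saturated k H & #|H| = sat k n.
Proof.
move=> /(@ex_Berge_saturated k 'I_n)[H0 /asboolP sH0].
pose P (H : {set {set 'I_n}}) := `[< Berge_saturated k H >].
have Pmax H : P H -> #|H| <= 'C(n, k).
  by move=> /asboolP[Hk _ _]; exact: uniform_card.
have /= := @bigmin_eq_arg _ nat _ 'C(n, k) H0 P (fun H => #|H|) sH0 Pmax.
case: Order.TotalTheory.arg_minP => // H /asboolP sH _ satE.
by exists H; rewrite // -satE.
Qed.

End Berge.

(* Main.v *)
(* Let t + 1 = |V(F)| - alpha(F) be the vertex cover number of F, so that
   t + 1 < 2 delta(F). Take t core vertices, split the others into blocks of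
   k - 1 vertices, and join each block to each core vertex by one hyperedge.
   Two adjacent vertices of F are incident to at least 2 delta(F) - 1 > t
   edges, so they cannot both lie in a block, which meets only t hyperedges; as
   a hyperedge meets only one block, a Berge-F would have an independent set
   outside the core, that is, a vertex cover of size t. So this hypergraph is
   Berge-F-free. Modify boundedly many hyperedges so that every pair of core
   vertices is covered as well, and extend to a saturated hypergraph. If a
   vertex c had many new hyperedges, they would give a star from c to vertices
   of distinct blocks, and c with the core would serve as the vertex cover of a
   Berge-F. Hence the number of new hyperedges is linear. *)
Require Import Defs.
From mathcomp Require Import all_boot all_order all_algebra.
From mathcomp Require Import boolp zify lra.
Set Implicit Arguments.
Unset Strict Implicit.
Unset Printing Implicit Defensive.

(** * Intervals of vertices *)

Section Range.
Variable n : nat.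

Definition range a b : {set 'I_n} := [set x : 'I_n | a <= x < b].

Lemma card_range a b : b <= n -> #|range a b| = b - a.
Proof.
move=> bn; rewrite -[RHS]card_ord.
have lt_n (i : 'I_(b - a)) : a + i < n by have := ltn_ord i; lia.
rewrite -(card_imset _ (f := fun i => Ordinal (lt_n i))); last first.
  by move=> i j [/addnI ?]; exact: val_inj.
apply: eq_card => x; rewrite inE; apply/idP/imsetP => [xab|[i _ ->]] /=.
  have xa : x - a < b - a by lia.
  by exists (Ordinal xa) => //; apply: val_inj => /=; lia.
by have := ltn_ord i; lia.
Qed.

Lemma card_range_le a b : #|range a b| <= b - a.
Proof.
have [bn|nb] := leqP b n; first by rewrite card_range.
have -> : range a b = range a n.
  by apply/setP => x; rewrite !inE; have := ltn_ord x; lia.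
by rewrite card_range // leq_sub2r // ltnW.
Qed.

Lemma disjoint_range a b a' b' : (b <= a') || (b' <= a) ->
  [disjoint range a b & range a' b'].
Proof.
by move=> bb; apply/pred0P => x /=; rewrite !inE; lia.
Qed.

End Range.

(** At most 2 ^ #|Z| sets lie inside [Z], so some member of [N] has a point [y0] outside [Z]. Adding
    to [Z] both [b y0] and the chosen set enlarges it by at most [d + k]; later points then avoid
    that set, which makes later sets different from it. *)
Lemma greedy_transversal (V : finType) (b : V -> {set V}) d k p
    (N : {set {set V}}) (Z : {set V}) :
  (forall x, #|b x| <= d) -> (forall h, h \in N -> #|h| <= k) ->
  2 ^ (#|Z| + p * (d + k)) < #|N| ->
  exists (y : nat -> V) (h : nat -> {set V}), forall i, i < p ->
    [/\ h i \in N, y i \in h i, y i \notin Z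
      & forall j, j < i -> y i \notin b (y j) /\ h i != h j].
Proof.
move=> bd Nk; elim: p Z => [|p IH] Z NZ.
  (* For [p = 0] only total functions have to be exhibited; an empty [V] would leave [N] with at
     most one member. *)
  have /card_gt0P[h _] : 0 < #|N| by exact: leq_ltn_trans NZ.
  have [y|V0] := pickP (@predT V); first by exists (fun=> y), (fun=> h).
  have N1 : #|N| <= 1.
    apply: (@leq_trans #|[set set0 : {set V}]|); last by rewrite cards1.
    apply/subset_leq_card/subsetP => A _; rewrite inE.
    by apply/eqP/setP => x; have := V0 x.
  by move: NZ; rewrite ltnNge (leq_trans N1) // expn_gt0.
have [h0 h0N h0Z] : exists2 h, h \in N & ~~ (h \subset Z).
  apply/subsetPn; apply: contraL NZ => /subsetP NZ; rewrite -leqNgt.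
  apply: (@leq_trans #|powerset Z|).
    by apply/subset_leq_card/subsetP => h /NZ; rewrite inE.
  by rewrite card_powerset leq_exp2l // leq_addr.
have /subsetPn[y0 y0h y0Z] := h0Z.
have [|y [h yh]] := IH (Z :|: (b y0 :|: h0)).
  apply: leq_ltn_trans NZ; rewrite leq_exp2l // mulSn addnA leq_add2r.
  rewrite (leq_trans (leq_card_setU _ _)) // leq_add2l.
  by rewrite (leq_trans (leq_card_setU _ _)) // leq_add // Nk.
exists (fun i => if i is i'.+1 then y i' else y0).
exists (fun i => if i is i'.+1 then h i' else h0).
case=> [|i] ip; first by split.
have [hN yhi yZ yj] := yh i ip.
move: yZ; rewrite !inE !negb_or => /and3P[yZ yb yh0].
split=> // -[_|j ji]; last exact: yj.
by split=> //; apply: contraNneq yh0 => <-.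
Qed.

(** * Counting in [F], and Berge copies as embeddings *)

Section Graph.
Variable F : sgraph.

Lemma edgesP (e : {set F}) :
  reflect (exists u v, adj u v /\ e = [set u; v]) (e \in edges F).
Proof.
apply: (iffP imsetP) => [[[u v]]|[u [v [uv ->]]]].
  by rewrite inE => uv ->; exists u, v.
by exists (u, v); rewrite ?inE.
Qed.

Lemma in_edges (u v : F) : adj u v -> [set u; v] \in edges F.
Proof. by move=> uv; apply/edgesP; exists u, v. Qed.

Lemma min_degree_le (x : F) : min_degree F <= degree x.
Proof. exact: (@Order.TotalTheory.bigmin_le_cond _ nat _ _ x predT). Qed.

Lemma independence_number_attained :
  exists2 I : {set F}, independent I & #|I| = independence_number F.
Proof.
have ind0 : 0 < #|[pred A : {set F} | independent A]|.
  apply/card_gt0P; exists set0; rewrite inE.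
  by apply/forall_inP => x; rewrite inE.
have [I indI IE] := eq_bigmax_cond (fun A : {set F} => #|A|) ind0.
by exists I; rewrite // /independence_number IE.
Qed.

Lemma independent_adj (A : {set F}) u v :
  independent A -> u \in A -> v \in A -> ~~ adj u v.
Proof. by move=> /forall_inP Ai /Ai /forall_inP; exact. Qed.

(** The stars at [u] and [v] share only the edge [uv]. *)
Lemma incident_edges (u v : F) : adj u v ->
  (degree u + degree v).-1 <=
    #|[set e in edges F | (u \in e) || (v \in e)]|.
Proof.
move=> uv.
have star_card (w : F) :
    degree w = #|[set [set w; x] | x in [set x | adj w x]]|.
  rewrite card_in_imset // => x y; rewrite !inE => wx wy /setP E.
  have := E x; rewrite !inE eqxx orbT => /esym/orP[/eqP xw|/eqP //].
  by move: wx; rewrite xw adj_irrefl.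
rewrite (star_card u) (star_card v) -cardsUI -subn1 leq_subLR addnC leq_add //.
  rewrite -(cards1 [set u; v]); apply/subset_leq_card/subsetP => e.
  rewrite !inE => /andP[/imsetP[x _ ->] /imsetP[y]]; rewrite inE => vy /setP E.
  have := E v; rewrite !inE eqxx => /orP[/eqP vu|/eqP <-]; last by [].
  by move: uv; rewrite vu adj_irrefl.
apply/subset_leq_card/subsetP => e; rewrite inE => /orP[] /imsetP[x];
  by rewrite inE => wx ->; rewrite !inE eqxx ?orbT andbT in_edges.
Qed.

(** Every vertex of [F] lies on an edge, whose image under [i] is inside the image of [j]; hence [i]
    factors through [j], and the common vertex set can be taken to be [V]. *)
Lemma Berge_embedding (V : finType) (H : {set {set V}}) :
  no_isolated_vertex F -> contains_Berge F H ->
  exists (f : F -> V) (phi : {set F} -> {set V}),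
    [/\ injective f, {in edges F &, injective phi}
      & forall e, e \in edges F -> phi e \in H /\ f @: e \subset phi e].
Proof.
move=> F0 [B /subsetP BH [W [i [j [phi [i_inj j_inj phi_inj phiE sub]]]]]].
have /choice[f fE] : forall v, exists x, j x = i v.
  move=> v; have /card_gt0P[u] := F0 v; rewrite inE => /in_edges vu.
  have /subsetP/(_ (i v)) := sub _ vu.
  by rewrite imset_f ?set21 // => /(_ isT)/imsetP[x _ ->]; exists x.
exists f, phi; split=> // [u v fuv|e eF].
  by apply: i_inj; rewrite -!fE fuv.
split; first by rewrite BH // -phiE imset_f.
apply/subsetP => _ /imsetP[v ve ->]; have /subsetP/(_ (i v)) := sub _ eF.
by rewrite imset_f // => /(_ isT)/imsetP[x xe]; rewrite -fE => /j_inj ->.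
Qed.

Lemma embedding_Berge (V : finType) (H : {set {set V}}) (f : F -> V)
    (phi : {set F} -> {set V}) :
  injective f -> {in edges F &, injective phi} ->
  (forall e, e \in edges F -> phi e \in H /\ f @: e \subset phi e) ->
  contains_Berge F H.
Proof.
move=> f_inj phi_inj phiH; exists (phi @: edges F).
  by apply/subsetP => _ /imsetP[e /phiH[eH _] ->].
exists V, f, id, phi; split=> // e /phiH[_]; by rewrite imset_id.
Qed.

Lemma saturated_extension k (V : finType) (H0 : {set {set V}}) :
  uniform k H0 -> ~ contains_Berge F H0 ->
  exists2 H, Berge_saturated F k H & H0 \subset H.
Proof.
move=> H0k H0F.
pose P (H : {set {set V}}) := `[< uniform k H /\ ~ contains_Berge F H >].
have P0 : P H0 by apply/asboolP.
have [H /maxsetP[/asboolP[Hk HF] Hmax] H0H] := maxset_exists P0.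
exists H => //; split=> // e ek eH; apply: contrapT => eF.
have /Hmax eHE : P (e |: H).
  by apply/asboolP; split=> // f; rewrite !inE => /orP[/eqP -> //|/Hk].
by move: eH; rewrite -(eHE (subsetUr _ _)) setU11.
Qed.

End Graph.

(** * The base hypergraph of core and blocks *)

Section Construction.
Variables (n t d : nat).

(** The core consists of the vertices below [t], and [d] stands for k - 1, so that a block and one
    core vertex make a hyperedge. *)
Definition block g : {set 'I_n} := range n (t + g * d) (t + g * d + d).

(* The block g = a * t + b with a != b < t has one hyperedge containing both core
   vertices a and b, at the price of the first vertex of the block. *)
Definition doubled g s := [&& g < t * t, s == g %% t & s != g %/ t].

Definition block_edge g s : {set 'I_n} :=
  range n s s.+1 :|:
  if doubled g s then
    range n (g %/ t) (g %/ t).+1 :|: range n (t + g * d).+1 (t + g * d + d)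
  else block g.

Definition base : {set {set 'I_n}} :=
  [set block_edge p.1 p.2 | p : 'I_((n - t) %/ d) * 'I_t].

Hypothesis d_gt0 : 0 < d.

Lemma in_block g (x : 'I_n) :
  (x \in block g) = (t <= x) && ((x - t) %/ d == g).
Proof.
rewrite inE; have := divn_eq (x - t) d; have := ltn_pmod (x - t) d_gt0.
set q := _ %/ d; set r := _ %% d => rd xE.
apply/idP/andP => [xg|[tx /eqP <-]]; last by lia.
by split; [lia | apply/eqP; nia].
Qed.

Lemma block_edge_out g s (x : 'I_n) : s < t -> t <= x ->
  x \in block_edge g s -> (x - t) %/ d = g.
Proof.
move=> st tx; rewrite !inE => /orP[|xg]; first by lia.
have : x \in block g.
  move: xg; case: ifP => // /and3P[gt _ _]; rewrite !inE.
  have : g %/ t < t by rewrite ltn_divLR // (leq_ltn_trans _ st).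
  by lia.
by rewrite in_block => /andP[_ /eqP].
Qed.

Lemma block_end g : g < (n - t) %/ d -> t + g * d + d <= n.
Proof.
move=> gm; have : g.+1 * d <= n - t by rewrite -leq_divRL.
by rewrite mulSn; lia.
Qed.

Lemma card_block_edge g s : g < (n - t) %/ d -> s < t ->
  #|block_edge g s| = d.+1.
Proof.
have cardU (A B : {set 'I_n}) : [disjoint A & B] -> #|A :|: B| = #|A| + #|B|.
  by move=> AB; rewrite cardsU disjoint_setI0 // cards0 subn0.
move=> /block_end gn st; rewrite /block_edge.
case: ifP => [/and3P[gt /eqP sE /eqP sg]|_].
  have at_ : g %/ t < t by rewrite ltn_divLR // (leq_ltn_trans _ st).
  rewrite !cardU ?card_range; try lia.
    by apply: disjoint_range; lia.
  by apply/pred0P => x /=; rewrite !inE; lia.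
by rewrite cardU ?card_range; try lia; apply: disjoint_range; lia.
Qed.

Lemma base_uniform : uniform d.+1 base.
Proof. by move=> _ /imsetP[[g s] _ ->]; exact: card_block_edge. Qed.

Lemma card_base : #|base| <= n * t.
Proof.
rewrite (leq_trans (leq_imset_card _ _)) // card_prod !card_ord leq_mul2r.
by rewrite (leq_trans (leq_div _ _)) ?leq_subr ?orbT.
Qed.

Lemma base_not_Berge (F : sgraph) : no_isolated_vertex F ->
  t + independence_number F < #|F| -> t.+1 < 2 * min_degree F ->
  ~ contains_Berge F base.
Proof.
move=> F0 tF tdeg /(Berge_embedding F0)[f [phi [f_inj phi_inj phiP]]].
pose core := [set v | f v < t].
have core_le : #|core| <= t.
  rewrite -(card_imset _ f_inj) -[t in _ <= t]subn0.
  apply: leq_trans (card_range_le n 0 t).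
  by apply/subset_leq_card/subsetP => _ /imsetP[v vt ->]; move: vt; rewrite !inE.
(* More than alpha(F) vertices are left outside [core], so it suffices that they are independent. *)
suff : #|~: core| <= independence_number F.
  by have := cardsC core; lia.
apply: leq_bigmax_cond; apply/forall_inP => u; rewrite !inE -leqNgt => tu.
apply/forall_inP => v; rewrite !inE -leqNgt => tv; apply/negP => uv.
have f_edge e w : e \in edges F -> w \in e -> t <= f w ->
    exists2 s : 'I_t, phi e = block_edge ((f w - t) %/ d) s & f w \in phi e.
  move=> eF we tw; have [/imsetP[[g s] _ phiE] /subsetP sub] := phiP e eF.
  have fw : f w \in phi e by rewrite sub // imset_f.
  exists s => //; rewrite phiE /=; congr (block_edge _ s).
  by apply/esym/(block_edge_out (ltn_ord s) tw); rewrite -[block_edge _ _]phiE.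
have uvE : (f u - t) %/ d = (f v - t) %/ d.
  have [|s phiE _] := f_edge _ u (in_edges uv) _ tu; first exact: set21.
  have [|s' _] := f_edge _ v (in_edges uv) _ tv; first exact: set22.
  by rewrite phiE => /(block_edge_out (ltn_ord s) tv).
have := incident_edges uv; have := min_degree_le u; have := min_degree_le v.
(* These edges receive distinct hyperedges, all from the common block of [f u] and [f v]. *)
suff : #|[set e in edges F | (u \in e) || (v \in e)]| <= t by lia.
rewrite -(card_in_imset (f := phi)); last first.
  by move=> e e'; rewrite !inE => /andP[eF _] /andP[eF' _]; exact: phi_inj.
apply: (@leq_trans #|[set block_edge ((f u - t) %/ d) s | s : 'I_t]|).
  apply/subset_leq_card/subsetP => _ /imsetP[e eE ->]; move: eE; rewrite inE.
  case/andP=> eF /orP[ue|ve].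
    by have [s phiE _] := f_edge e u eF ue tu; rewrite phiE; exact: imset_f.
  by have [s phiE _] := f_edge e v eF ve tv; rewrite phiE uvE; exact: imset_f.
by rewrite -[t in _ <= t]card_ord leq_imset_card.
Qed.

(** * A Berge copy of [F] from a star of new hyperedges *)

(* The core, the blocks with doubled hyperedges and the incomplete last block. *)
Definition irregular : {set 'I_n} :=
  range n 0 (t + t * t * d) :|: range n (t + (n - t) %/ d * d) n.

Lemma card_irregular : #|irregular| <= t + t * t * d + d.
Proof.
rewrite (leq_trans (leq_card_setU _ _)) // leq_add //.
  by rewrite -[X in _ <= X]subn0 card_range_le.
rewrite (leq_trans (card_range_le _ _ _)) //.
by have := divn_eq (n - t) d; have := ltn_pmod (n - t) d_gt0; lia.
Qed.

Lemma regularP (x : 'I_n) : x \notin irregular ->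
  [/\ t <= x, t * t <= (x - t) %/ d & (x - t) %/ d < (n - t) %/ d].
Proof.
rewrite !inE; have xn := ltn_ord x; move=> xI; split; first by lia.
  by rewrite leq_divRL //; lia.
by rewrite ltn_divLR //; lia.
Qed.

Lemma mem_block_edge g s (x : 'I_n) : ~~ doubled g s ->
  (x \in block_edge g s) = (x == s :> nat) || (x \in block g).
Proof.
by move=> /negPf gs; rewrite /block_edge gs inE; congr (_ || _); rewrite inE; lia.
Qed.

Lemma mem_doubled_edge a b (x : 'I_n) : a < t -> b < t -> a != b ->
  (x \in block_edge (a * t + b) b) =
    [|| x == b :> nat, x == a :> nat
      | t + (a * t + b) * d < x < t + (a * t + b) * d + d].
Proof.
move=> at_ bt ab; have t0 : 0 < t by lia.
have gmod : (a * t + b) %% t = b by rewrite modnMDl modn_small.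
have gdiv : (a * t + b) %/ t = a by rewrite divnMDl // divn_small // addn0.
rewrite /block_edge /doubled gmod gdiv eqxx (eq_sym b) ab !andbT.
have -> : a * t + b < t * t by nia.
by rewrite !inE; lia.
Qed.

(** Of the vertex cover [~: I], one vertex [c0] goes to [c] and the other [t] fill the core, while
    [I] is sent to the points [y]. The edges from [c0] to [I] use the star [h]; all others meet the
    core and use [base]. *)
Lemma star_Berge (F : sgraph) (I : {set F}) (H : {set {set 'I_n}}) (c : 'I_n)
    (y : F -> 'I_n) (h : F -> {set 'I_n}) :
  independent I -> #|~: I| = t.+1 -> base \subset H ->
  c \notin irregular ->
  (forall v, [/\ h v \in H :\: base, c \in h v & y v \in h v]) ->
  (forall v, y v \notin irregular /\ y v \notin block ((c - t) %/ d)) ->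
  (forall u v, u != v ->
     h u != h v /\ y u \notin block ((y v - t) %/ d)) ->
  contains_Berge F H.
Proof.
move=> indI cardI /subsetP baseH c_reg hP y_reg hy_inj.
have /card_gt0P[c0 c0I] : 0 < #|~: I| by rewrite cardI.
have size_core : size (enum (~: I :\ c0)) = t.
  by rewrite -cardE; have := cardsD1 c0 (~: I); rewrite c0I cardI => -[].
(* For [v] in the list the index is below [t <= c < n], so [insubd] returns it and not the default
   [c]. *)
pose core v := insubd c (index v (enum (~: I :\ c0))).
pose f v := if v \in I then y v else if v == c0 then c else core v.
pose out v := (v \in I) || (v == c0).
have [tc _ _] := regularP c_reg.
have coreE v : ~~ out v ->
    [/\ v \in enum (~: I :\ c0), f v = index v (enum (~: I :\ c0)) :> nat
      & f v < t].
  rewrite /f negb_or => /andP[vI vc0]; rewrite (negPf vI) (negPf vc0).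
  have v_core : v \in enum (~: I :\ c0) by rewrite mem_enum !inE vI vc0.
  have vt : index v (enum (~: I :\ c0)) < t by rewrite -size_core index_mem.
  by rewrite val_insubd (ltn_trans vt) // (leq_ltn_trans tc).
have f_reg v : out v -> f v \notin irregular.
  by rewrite /f /out; case: ifP => [_ _|_ /= ->//]; have [] := y_reg v.
have f_out v : (t <= f v) = out v.
  apply/idP/idP => [|/f_reg/regularP[]//].
  by apply: contraTT => /coreE[_ _]; rewrite ltnNge.
have y_idx v : (y v - t) %/ d != (c - t) %/ d.
  have [/regularP[tv _ _]] := y_reg v.
  by rewrite in_block tv.
have idx_inj u v : out u -> out v ->
    (f u - t) %/ d = (f v - t) %/ d -> u = v.
  rewrite /f /out; case: (u \in I) => /=; case: (v \in I) => /=.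
  - move=> _ _ /eqP; apply: contraTeq => /hy_inj[_].
    by have [/regularP[tu _ _] _] := y_reg u; rewrite in_block tu.
  - by move=> _ -> E; have := y_idx u; rewrite E eqxx.
  - by move=> -> _ E; have := y_idx v; rewrite E eqxx.
  - by move=> /eqP-> /eqP->.
have f_inj : injective f.
  move=> u v fuv; have [ou|nou] := boolP (out u).
    by apply: idx_inj; rewrite ?fuv // -f_out -fuv f_out.
  have nov : ~~ out v by rewrite -f_out -fuv f_out.
  have [uS uE _] := coreE _ nou; have [vS vE _] := coreE _ nov.
  by apply: (index_inj v uS vS); rewrite -uE -vE fuv.
(* The hyperedges of base meet the image of f exactly in the image of e, which
   makes the choice of hyperedges injective. *)
pose P (e : {set F}) (A : {set 'I_n}) :=
  (A \in base /\ forall w, (f w \in A) = (w \in e)) \/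
  exists2 u, u \in I & e = [set c0; u] /\ A = h u.
(* The block of [f u] has index at least [t * t], so its hyperedges are not doubled, and [idx_inj]
   keeps other images out of it. *)
have mixed u v : out u -> ~~ out v -> exists A, P [set u; v] A.
  move=> ou nov; have [tu ltu um] := regularP (f_reg _ ou).
  have [_ _ vt] := coreE _ nov.
  exists (block_edge ((f u - t) %/ d) (f v)); left; split.
    by apply/imsetP; exists (Ordinal um, Ordinal vt).
  move=> w; rewrite mem_block_edge; last first.
    by rewrite /doubled ltnNge ltu.
  rewrite in_block f_out !inE orbC (inj_eq val_inj) (inj_eq f_inj).
  congr (_ || _); apply/andP/eqP => [[ow /eqP /idx_inj->//]|->].
  by rewrite ou eqxx.
have /choice[phi phiP] : forall e, exists A, e \in edges F -> P e A.
  move=> e; have [/edgesP[u [v [uv ->]]]|_] := boolP (e \in edges F); last first.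
    by exists set0.
  suff [A PA] : exists A, P [set u; v] A by exists A.
  have [ou|nou] := boolP (out u); have [ov|nov] := boolP (out v).
  - have [uI|uI] := boolP (u \in I).
      have vI : v \notin I by apply: contraL uv; exact: independent_adj.
      move: ov; rewrite /out (negPf vI) /= => /eqP->.
      by exists (h u); right; exists u; rewrite // setUC.
    move: ou; rewrite /out (negPf uI) /= => /eqP uc0; rewrite uc0.
    have vI : v \in I.
      move: ov; rewrite /out => /orP[//|/eqP vc0].
      by move: uv; rewrite uc0 vc0 adj_irrefl.
    by exists (h v); right; exists v.
  - exact: mixed.
  - by rewrite setUC; exact: mixed.
  - have [_ _ ut] := coreE _ nou; have [_ _ vt] := coreE _ nov.
    have fuv : f u != f v :> nat.
      apply: contraTneq uv => /val_inj/f_inj->; by rewrite adj_irrefl.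
    (* The block of [c] comes after all [t * t] blocks that may be doubled, so those blocks are
       complete. *)
    have [_ c_lo c_hi] := regularP c_reg.
    have gt : f u * t + f v < t * t by nia.
    have gm : f u * t + f v < (n - t) %/ d by lia.
    exists (block_edge (f u * t + f v) (f v)); left; split.
      by apply/imsetP; exists (Ordinal gm, Ordinal vt).
    move=> w; rewrite mem_doubled_edge // !inE !(inj_eq val_inj) !(inj_eq f_inj).
    (* No [f w] lies in the block part: outside the core, images are regular and have block index at
       least [t * t]. *)
    rewrite orbA [(w == v) || _]orbC orb_idr // => w_block.
    have tw : t <= f w by lia.
    have ow : out w by rewrite -f_out.
    have [_ + _] := regularP (f_reg w ow).
    have : f w \in block (f u * t + f v) by rewrite inE; lia.
    by rewrite in_block => /andP[_ /eqP->]; rewrite leqNgt gt.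
apply: (@embedding_Berge F _ H f phi f_inj) => [e e' eF e'F phiE|e eF].
  case: (phiP e eF) (phiP e' e'F) => [[A_base Ae]|[u uI [eE Ae]]];
    rewrite -phiE => -[[A'_base Ae']|[u' uI' [e'E Ae']]].
  - by apply/setP => w; rewrite -Ae -Ae'.
  - by have [] := hP u'; rewrite -Ae' !inE A_base.
  - by have [] := hP u; rewrite -Ae !inE A'_base.
  - rewrite eE e'E; congr [set c0; _]; apply/eqP; move/eqP: Ae'; rewrite Ae.
    by apply: contraTT => /hy_inj[].
have [[A_base Ae]|[u uI [-> ->]]] := phiP e eF.
  split; first exact: baseH.
  by apply/subsetP => _ /imsetP[w we ->]; rewrite Ae.
have [hH ch yh] := hP u; split; first by move: hH; rewrite inE => /andP[].
apply/subsetP => _ /imsetP[w + ->]; rewrite !inE => /orP[]/eqP->.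
  by rewrite /f eqxx; move: c0I; rewrite inE => /negPf->.
by rewrite /f uI.
Qed.

(** * Counting the new hyperedges *)

(** The threshold of [greedy_transversal] for #|F| points of hyperedges of size [d.+1], avoiding
    [irregular] and the block of [c]. *)
Definition degree_bound (F : sgraph) :=
  2 ^ (t + t * t * d + d + d + #|F| * (d + d.+1)).

Lemma new_degree_le (F : sgraph) (I : {set F}) (H : {set {set 'I_n}}) c :
  independent I -> #|~: I| = t.+1 -> base \subset H -> uniform d.+1 H ->
  ~ contains_Berge F H -> c \notin irregular ->
  #|[set e in H :\: base | c \in e]| <= degree_bound F.
Proof.
move=> indI cardI baseH Hk HF c_reg; rewrite leqNgt; apply/negP => large.
pose b (x : 'I_n) := block ((x - t) %/ d).
have b_card x : #|b x| <= d.
  by rewrite (leq_trans (card_range_le _ _ _)) // addKn.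
have [A||y [h yh]] := @greedy_transversal _ b d d.+1 #|F|
  [set e in H :\: base | c \in e] (irregular :|: b c) b_card.
- by rewrite !inE => /andP[/andP[_ /Hk->]].
- apply: leq_ltn_trans large; rewrite leq_exp2l // leq_add2r.
  rewrite (leq_trans (leq_card_setU _ _)) // leq_add //.
  exact: card_irregular.
have rank_lt (v : F) : enum_rank v < #|F| by exact: ltn_ord.
have y_reg (v : F) : y (enum_rank v) \notin irregular /\ y (enum_rank v) \notin b c.
  have [_ _ + _] := yh _ (rank_lt v).
  by rewrite in_setU negb_or => /andP.
apply: HF; apply: (@star_Berge F I H c (fun v : F => y (enum_rank v))
  (fun v : F => h (enum_rank v))) => // [v|u v].
  by have [+ yhv _ _] := yh _ (rank_lt v); rewrite in_set => /andP[].
(* The greedy choice separates only later points from earlier ones; for regular points, lying in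
   different blocks is symmetric. *)
have b_sym : y (enum_rank v) \notin b (y (enum_rank u)) ->
    y (enum_rank u) \notin b (y (enum_rank v)).
  have [/regularP[tu _ _] _] := y_reg u; have [/regularP[tv _ _] _] := y_reg v.
  by rewrite !in_block tu tv eq_sym.
rewrite -(inj_eq enum_rank_inj) -(inj_eq val_inj) neq_ltn => /orP[] lt_uv.
  have [_ _ _ /(_ _ lt_uv)[yb hne]] := yh _ (rank_lt v).
  by split; [rewrite eq_sym | exact: b_sym].
by have [_ _ _ /(_ _ lt_uv)[yb hne]] := yh _ (rank_lt u).
Qed.

(** A hyperedge is in [base], or is a subset of the bounded set [irregular], or is new and contains
    a regular vertex, where [new_degree_le] applies. *)
Lemma saturated_card_le (F : sgraph) (I : {set F}) (H : {set {set 'I_n}}) :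
  independent I -> #|~: I| = t.+1 -> base \subset H -> uniform d.+1 H ->
  ~ contains_Berge F H ->
  #|H| <= n * t + (2 ^ (t + t * t * d + d) + n * degree_bound F).
Proof.
move=> indI cardI baseH Hk HF.
pose new c := [set e in H :\: base | c \in e].
have sub : H \subset
    base :|: (powerset irregular :|: \bigcup_(c | c \notin irregular) new c).
  apply/subsetP => e eH; rewrite !in_setU powersetE.
  have [//|eb /=] := boolP (e \in base).
  have [//|/subsetPn[c ce c_reg] /=] := boolP (e \subset irregular).
  by apply/bigcupP; exists c; rewrite // !inE eb eH.
rewrite (leq_trans (subset_leq_card sub)) //.
rewrite (leq_trans (leq_card_setU _ _)) // leq_add ?card_base //.
rewrite (leq_trans (leq_card_setU _ _)) // leq_add //.
  by rewrite card_powerset leq_exp2l // card_irregular.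
have card_bigcup (P : pred 'I_n) :
    #|\bigcup_(c | P c) new c| <= \sum_(c | P c) #|new c|.
  elim/big_rec2: _ => [|c x A _ IH]; first by rewrite cards0.
  by rewrite (leq_trans (leq_card_setU _ _)) // leq_add2l.
rewrite (leq_trans (card_bigcup _)) //.
apply: (@leq_trans (\sum_(c : 'I_n | c \notin irregular) degree_bound F)).
  by apply: leq_sum => c c_reg; exact: (new_degree_le indI).
rewrite sum_nat_const leq_mul // -[X in _ <= X]card_ord; exact: max_card.
Qed.

End Construction.

Theorem theorem1p3 (F : sgraph) (k : nat)
    (F_has_edge : edges F != set0)
    (F_no_isolated : no_isolated_vertex F)
    (F_degree : ((#|F|%:R - (independence_number F)%:R) / 2%:R
                 < (min_degree F)%:R :> rat)%R)
    (k_ge3 : 3 <= k) :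
  exists C n0 : nat, forall n : nat, n0 <= n -> sat F k n <= C * n.
Proof.
have F_deg : #|F| < 2 * min_degree F + independence_number F.
  by rewrite -(Num.Theory.ltr_nat rat) GRing.natrD GRing.natrM; lra.
have [I indI cardI] := independence_number_attained F.
have cardIC := cardsC I; rewrite cardI in cardIC.
(* An edge of [F] prevents [I] from being everything, so [t] below satisfies t + 1 = |V(F)| -
   alpha(F) without truncation. *)
have IC_gt0 : 0 < #|~: I|.
  rewrite lt0n cards_eq0; apply/eqP => I0.
  have IT v : v \in I by apply/negPn; rewrite -in_setC I0 inE.
  have /set0Pn[e /edgesP[u [v [uv _]]]] := F_has_edge.
  by move: uv; rewrite (negPf (independent_adj indI (IT u) (IT v))).
case: k k_ge3 => [//|d] d_ge2; have d_gt0 : 0 < d by exact: ltnW.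
pose t := #|~: I|.-1.
have tE : #|~: I| = t.+1 by rewrite prednK.
(* For [n >= 1] the constant number of new hyperedges inside [irregular] is absorbed into a multiple
   of [n]. *)
exists (t + 2 ^ (t + t * t * d + d) + degree_bound t d F), 1 => n n_gt0.
have base_F : ~ contains_Berge F (base n t d).
  by apply: base_not_Berge => //; lia.
have [H Hsat baseH] := saturated_extension (base_uniform d_gt0) base_F.
have [Hk HF _] := Hsat.
rewrite (leq_trans (sat_min Hsat)) //.
rewrite (leq_trans (saturated_card_le d_gt0 indI tE baseH Hk HF)) //.
by rewrite !mulnDl addnA [degree_bound _ _ _ * n]mulnC [t * n]mulnC
  leq_add2r leq_add2l leq_pmulr.
Qed.
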